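(* Let $n$ be a positive integer. (1) There exists a unique polynomial $\mathscr{T}_n(x,y,(z_I))$ (with rational coefficients) in $x$, $y$ and the $2^n-1$ variables $z_I$ indexed by the nonempty subsets $I$ of $[n]$, such that, for any submodular function $f:2^{[n]}\to\mathbb{Z}$, the specialization of $\mathscr{T}_n$ at $z_I=f(I)$ for all nonempty $I\subseteq[n]$ is the polymatroid Tutte polynomial of the polymatroid $P_f$: $$\mathscr{T}_{P_f}(x,y)=\mathscr{T}_n(x,y,(z_I))\big|_{z_I=f(I)\ \forall I}.$$ (2) The polynomial $\mathscr{T}_n$ has total degree $n$ (in all the variables $x,y,z_I$), and $(n-1)!\,\mathscr{T}_n$ has integer coefficients.
   Context: Notation: $[n]=\{1,\dots,n\}$; $\mathbf e_1,\dots,\mathbf e_n$ is the canonical basis of $\mathbb{R}^n$. A function $f:2^{[n]}\to\mathbb{Z}$ is submodular if $f(\varnothing)=0$ and $f(I)+f(J)\ge f(I\cup J)+f(I\cap J)$ for all $I,J\subseteq[n]$. The associated polymatroid is $$P_f=\Big\{\mathbf x\in\mathbb{Z}^n\ \Big|\ \sum_{i\in I}x_i\le f(I)\ \text{for all } I\subseteq[n],\ \text{and}\ \sum_{i\in[n]}x_i=f([n])\Big\}.$$ A polymatroid in $\mathbb{Z}^n$ is a finite nonempty set $P\subset\mathbb{Z}^n$ satisfying the Exchange Axiom: for any $\mathbf a,\mathbf b\in P$ and any $i\in[n]$ with $a_i>b_i$, there exists $j\in[n]$ such that $a_j<b_j$ and both $\mathbf a-\mathbf e_i+\mathbf e_j$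 and $\mathbf b+\mathbf e_i-\mathbf e_j$ belong to $P$. (The map $f\mapsto P_f$ is a bijection from integer submodular functions to polymatroids in $\mathbb{Z}^n$, with inverse sending $P$ to its rank function $I\mapsto\max_{\mathbf a\in P}\sum_{i\in I}a_i$.) For $\mathbf a\in P$, an index $i\in[n]$ is internally active if there is no $j<i$ with $\mathbf a-\mathbf e_i+\mathbf e_j\in P$, and externally active if there is no $j<i$ with $\mathbf a+\mathbf e_i-\mathbf e_j\in P$. Let $\mathrm{Int}(\mathbf a),\mathrm{Ext}(\mathbf a)\subseteq[n]$ be the sets of internally, respectively externally, active indices. The polymatroid Tutte polynomial is $$\mathscr{T}_P(x,y)=\sum_{\mathbf a\in P}x^{|\mathrm{Int}(\mathbf a)\setminus\mathrm{Ext}(\mathbf a)|}\,y^{|\mathrm{Ext}(\mathbf a)\setminus\mathrm{Int}(\mathbf a)|}\,(x+y-1)^{|\mathrm{Int}(\mathbf a)\cap\mathrm{Ext}(\mathbf a)|}.$$ *)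

(* Defs.v *)
From mathcomp Require Import all_boot all_order all_algebra.
From mathcomp Require Import finmap.
From mathcomp Require Export mpoly.

Set Implicit Arguments.
Unset Strict Implicit.
Unset Printing Implicit Defensive.

Import Order.TTheory GRing.Theory Num.Theory.
Local Open Scope ring_scope.

(* The ground set [n] is 'I_n (shifted to {0, ..., n-1}, same order), and
   points of Z^n are row vectors, so that the i-th canonical basis vector is
   delta_mx 0 i. *)

Definition submodular n (f : {set 'I_n} -> int) : Prop :=
  f set0 = 0 /\ forall I J : {set 'I_n}, f (I :|: J) + f (I :&: J) <= f I + f J.

Definition in_polymatroid n (f : {set 'I_n} -> int) (x : 'rV[int]_n) : bool :=
  [forall I : {set 'I_n}, \sum_(i in I) x 0 i <= f I]
    && (\sum_(i < n) x 0 i == f [set: 'I_n]).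

Definition box n (N : nat) : {fset 'rV[int]_n} :=
  [fset \row_i ((g i : nat)%:Z - N%:Z)
    | g : {ffun 'I_n -> 'I_N.*2.+1} in predT]%fset.

(* Intersecting with the box only serves to get a finite set; by
   polymatroidP below it discards no point. *)
Definition polymatroid n (f : {set 'I_n} -> int) : {fset 'rV[int]_n} :=
  [fset x in box n (\sum_(I : {set 'I_n}) `|f I|)%N.*2 | in_polymatroid f x]%fset.

Section Tutte.
Variables (n : nat) (P : {fset 'rV[int]_n}).

Definition int_active (a : 'rV[int]_n) : {set 'I_n} :=
  [set i : 'I_n | ~~ [exists j : 'I_n,
     (j < i)%N && (a - delta_mx 0 i + delta_mx 0 j \in P)]].

Definition ext_active (a : 'rV[int]_n) : {set 'I_n} :=
  [set i : 'I_n | ~~ [exists j : 'I_n,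
     (j < i)%N && (a + delta_mx 0 i - delta_mx 0 j \in P)]].

(* The variables x and y are 'X_0 and 'X_1. *)
Definition tutte : {mpoly int[2]} :=
  \sum_(a <- P)
    'X_0 ^+ #|int_active a :\: ext_active a|
      * 'X_1 ^+ #|ext_active a :\: int_active a|
      * ('X_0 + 'X_1 - 1) ^+ #|int_active a :&: ext_active a|.

End Tutte.

(* Variables of the universal polynomial: inl k is the k-th of x, y, and
   inr J is z_J.  Multivariate polynomials being indexed by ordinals, these
   are numbered through enum_val. *)
Definition var n : finType := ('I_2 + {I : {set 'I_n} | I != set0})%type.

Definition specialize n (f : {set 'I_n} -> int) (T : {mpoly rat[#|var n|]}) :
    {mpoly rat[2]} :=
  T \mPo [tuple match enum_val k : var n with
                | inl i => 'X_i
                | inr J => ((f (val J))%:~R)%:MP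
                end | k < #|var n|].

Definition interpolates_tutte n (T : {mpoly rat[#|var n|]}) : Prop :=
  forall f : {set 'I_n} -> int, submodular f ->
    specialize f T = map_mpoly intr (tutte (polymatroid f)).

Lemma boxP n N (x : 'rV[int]_n) :
  (forall i, `|x 0 i| <= N%:Z) -> x \in box n N.
Proof.
move=> xN; apply/imfsetP.
exists [ffun i => inord (absz (x 0 i + N%:Z))] => //=.
apply/rowP=> i; rewrite mxE ffunE.
have /andP[xl xu] : - N%:Z <= x 0 i <= N%:Z by rewrite -ler_norml.
have xi0 : 0 <= x 0 i + N%:Z by rewrite -lerBlDr sub0r.
rewrite inordK; first by rewrite gez0_abs // addrK.
by rewrite ltnS -lez_nat gez0_abs // -addnn PoszD lerD2r.
Qed.

Lemma polymatroidP n (f : {set 'I_n} -> int) (x : 'rV[int]_n) :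
  reflect ((forall I : {set 'I_n}, \sum_(i in I) x 0 i <= f I)
             /\ \sum_(i < n) x 0 i = f [set: 'I_n])
          (x \in polymatroid f).
Proof.
have xP : reflect ((forall I : {set 'I_n}, \sum_(i in I) x 0 i <= f I)
             /\ \sum_(i < n) x 0 i = f [set: 'I_n]) (in_polymatroid f x).
  by apply: (iffP andP) => -[/forallP ? /eqP ?].
suff -> : (x \in polymatroid f) = in_polymatroid f x by [].
rewrite /polymatroid !inE /=; apply/andb_idl => /xP[xle xE].
apply: boxP => i.
set N := (\sum_I _)%N.
have fN I : `|f I| <= N%:Z by rewrite -abszE lez_nat /N (bigD1 I) //= leq_addr.
rewrite -addnn PoszD ler_norml; apply/andP; split.
  have -> : x 0 i = f setT - \sum_(j in ~: [set i]) x 0 j.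
    rewrite -xE (bigD1 i) //= [X in _ - X](eq_bigl (fun j => j != i)) ?addrK //.
    by move=> j; rewrite !inE.
  rewrite opprD lerB //; first by have := fN setT; rewrite ler_norml => /andP[].
  by apply: le_trans (xle _) _; have := fN (~: [set i]); rewrite ler_norml => /andP[].
have := xle [set i]; rewrite big_set1 => /le_trans; apply.
by apply: le_trans (ler_norm _) _; apply: le_trans (fN _) _; rewrite lerDl.
Qed.

(* Main.v *)
Require Import Defs.
From mathcomp Require Import all_boot all_order all_algebra.
From mathcomp Require Import finmap zify ring.

Set Implicit Arguments.
Unset Strict Implicit.
Unset Printing Implicit Defensive.

Import Order.TTheory GRing.Theory Num.Theory.
Local Open Scope ring_scope.

(** Let [k] be the last element of the ground set.  Cutting a polymatroid [P_f]
    along the value [t] of its last coordinate gives polymatroids [P_t] with one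
    coordinate less, with rank function [I |-> min (f I) (f (I + k) - t)], and
    since activities only look at smaller indices,

      T(P_f) = x T(P_lo) + (y - 1) T(P_hi) + sum_(lo < t <= hi) T(P_t)

    where [lo] and [hi] are the extreme values of the last coordinate
    ([tutte_recursion]).  By induction each [T(P_t)] is a polynomial in the
    values of its rank function.  These values are only piecewise affine in
    [t]: the one at [I] changes its expression at the jump
    [c_I = f (I + k) - f I].  The order of the jumps depends on [f], so that the
    sum over [t] could a priori depend on [f] in a merely piecewise polynomial
    way.

    The point is to strengthen the induction: [T_n] is a sum of polynomials each
    of which only involves the [z_I] for [I] in a chain of sets.  Submodularity
    makes [c_I] decreasing in [I], so along a chain [C_0, ..., C_n] the jumps
    come in a fixed order, and the sum over [t] splits into sums over the intervals
    from [c_(C_(j+1))] to [c_(C_j)], on which the rank function is affine in [t]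
    along the chain.  Such a sum is the difference of the values of one discrete
    primitive at the two ends, and these two values are again supported on
    chains, obtained by inserting [k] into [C] at positions [j] and [j + 1]
    ([supported_slice_sum], [chain_poly_step], [tutte_chain_poly]).

    Each step adds at most one to the total degree and to the degree in the
    [z_I], and the first step adds nothing to the latter; so the total degree is
    at most [n] and the degree in the [z_I] at most [n - 1].  The coefficients of
    the monomials in [x] and [y] take integer values at integer points, and
    Newton's formula bounds their denominators by [(n - 1)!] ([deg_lt_mpoly]).

    Uniqueness holds because submodular functions are Zariski dense
    ([mpoly_submodular_eval0]), and the degree is exactly [n] because the zero
    function specializes [T_n] to [(x + y - 1) ^ n] ([msize_interpolates]). *)

(** * Summation over integer intervals *)

Section IntegerSums.
Variable A : zmodType.
Implicit Types g h : int -> A.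

(** A discrete primitive of [g]: the sum of [g] over the integers in [(0, t]],
    with the sign convention of an oriented integral when [t] is negative. *)
Definition psum g (t : int) : A :=
  match t with
  | Posz m => \sum_(i < m) g i.+1%:Z
  | Negz m => - \sum_(i < m.+1) g (- i%:Z)
  end.

Lemma psumS g t : psum g (t + 1) = g (t + 1) + psum g t.
Proof.
case: t => [m | [|m]].
- by rewrite -PoszD addn1 /= big_ord_recr /= addrC.
- by rewrite (_ : Negz 0 + 1 = 0) //= big_ord0 big_ord1 oppr0 subrr.
- have -> : Negz m.+1 + 1 = Negz m by rewrite !NegzE; lia.
  by rewrite /= [in RHS]big_ord_recr /= opprD addrCA NegzE subrr addr0.
Qed.

Lemma eq_psum g h : g =1 h -> psum g =1 psum h.
Proof.
by move=> gh [m|m] /=; [|congr (- _)]; apply: eq_bigr => i _; apply: gh.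
Qed.

Lemma constant_int (B : Type) (k : int -> B) :
  (forall t, k (t + 1) = k t) -> forall s t, k s = k t.
Proof.
move=> kS; suff k0 t : k t = k 0 by move=> s t; rewrite !k0.
elim/int_ind: t => [//|n IH|n IH]; first by rewrite intS addrC kS.
by rewrite -IH -kS; congr k; lia.
Qed.

Lemma psum_telescope g h a b :
  (forall t, h (t + 1) = g (t + 1) + h t) -> psum g b - psum g a = h b - h a.
Proof.
move=> gh; have E := @constant_int _ (fun t => psum g t - h t).
have {}E : psum g b - h b = psum g a - h a.
  by apply: (E _ b a) => t; rewrite psumS gh opprD addrACA subrr add0r.
by rewrite -[psum g b](subrK (h b)) E addrAC [_ - h a]addrC addrK addrC.
Qed.

Lemma psum_uniq g h t : h 0 = 0 ->
  (forall t, h (t + 1) = g (t + 1) + h t) -> psum g t = h t.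
Proof.
move=> h0 hS; have := psum_telescope 0 t hS.
by rewrite h0 (_ : psum g 0 = 0) ?subr0 //= big_ord0.
Qed.

Lemma psum_eq_in g h a b : a <= b ->
    (forall t, a < t <= b -> g t = h t) ->
  psum g b - psum g a = psum h b - psum h a.
Proof.
move=> le_ab; have [n ->] : exists n : nat, b = a + n%:Z.
  by exists `|b - a|%N; rewrite gez0_abs ?subr_ge0 //; lia.
elim: n => [|n IH] gh; first by rewrite addr0 !subrr.
have -> : a + n.+1%:Z = a + n%:Z + 1 by rewrite -addn1 PoszD addrA.
rewrite !psumS -!addrA IH => [|t ht]; last by apply: gh; lia.
by rewrite gh //; lia.
Qed.

Lemma psumD g h t : psum (fun u => g u + h u) t = psum g t + psum h t.
Proof.
apply: (psum_uniq (h := fun t => psum g t + psum h t)) => [|u].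
  by rewrite /= !big_ord0 addr0.
by rewrite !psumS addrACA.
Qed.
End IntegerSums.

Lemma psum_mulrz (A : zmodType) (P : A) (c : int -> int) t :
  psum (fun u => P *~ c u) t = P *~ psum c t.
Proof.
apply: (psum_uniq (h := fun t => P *~ psum c t)) => [|u].
  by rewrite /= big_ord0.
by rewrite psumS mulrzDr.
Qed.

(** * The deletion recursion for the polymatroid Tutte polynomial *)

Section TightSets.
Variables (m : nat) (f : {set 'I_m} -> int).
Hypothesis f_sub : submodular f.
Implicit Types (x : 'rV[int]_m) (I J : {set 'I_m}) (i j : 'I_m).

Definition tight x I := \sum_(i in I) x 0 i == f I.

Lemma sum_setUI x I J :
  \sum_(i in I :|: J) x 0 i + \sum_(i in I :&: J) x 0 i =
  \sum_(i in I) x 0 i + \sum_(i in J) x 0 i.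
Proof.
rewrite (big_setID I) /= [in RHS](big_setID (A := J) I) /=.
by rewrite setUK setDUl setDv set0U setIC [J :&: I]setIC -addrA
           [X in _ + X]addrC.
Qed.

(** Tight sets form a lattice, by submodularity. *)
Lemma tightUI x I J : x \in polymatroid f ->
  tight x I -> tight x J -> tight x (I :|: J) && tight x (I :&: J).
Proof.
move=> /polymatroidP[xle _] /eqP tI /eqP tJ.
have := f_sub.2 I J; rewrite -tI -tJ -sum_setUI => le_f.
rewrite /tight !eq_le !xle /=; have := xle (I :&: J); have := xle (I :|: J).
move: le_f; move: (\sum_(i in _) _) (\sum_(i in _) _) => a b; lia.
Qed.

Lemma sum_exchange x i j I :
  \sum_(k in I) (x - delta_mx 0 i + delta_mx 0 j) 0 k =
  \sum_(k in I) x 0 k - (i \in I)%:R + (j \in I)%:R.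
Proof.
have sum_delta l : \sum_(k in I) (delta_mx 0 l : 'rV[int]_m) 0 k = (l \in I)%:R.
  rewrite big_mkcond (bigD1 l) //= big1 ?addr0 => [|k /negbTE kl].
    by rewrite mxE !eqxx; case: (l \in I).
  by rewrite mxE kl andbF if_same.
rewrite -!sum_delta -sumrB -big_split /=; apply: eq_bigr => k _.
by rewrite !mxE.
Qed.

(** The only obstruction to moving a unit from [i] to [j] is a tight set that
    the move would overload. *)
Lemma exchange_blocked x i j : x \in polymatroid f ->
  x - delta_mx 0 i + delta_mx 0 j \notin polymatroid f ->
  exists I, [&& tight x I, j \in I & i \notin I].
Proof.
move=> /polymatroidP[xle xE] xij; apply/existsP; apply: contraNT xij.
move=> /existsPn noI; apply/polymatroidP; split=> [I|].
  rewrite sum_exchange; have := noI I.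
  rewrite /tight eq_le xle /=; have := xle I; move: (\sum_(k in I) _) => s.
  by case: (j \in I); case: (i \in I) => /=; lia.
have sumT (y : 'rV[int]_m) : \sum_k y 0 k = \sum_(k in setT) y 0 k.
  by apply: eq_bigl => k; rewrite inE.
by rewrite sumT sum_exchange !inE subrK -sumT.
Qed.
End TightSets.

Section Slices.
Variable n : nat.
Local Notation up := (lift (@ord_max n)).
Implicit Types (f : {set 'I_n.+1} -> int) (I J : {set 'I_n}).
Implicit Types (x : 'rV[int]_n.+1) (a : 'rV[int]_n).

Definition up_set I : {set 'I_n.+1} := up @: I.
Definition cone_set I : {set 'I_n.+1} := ord_max |: up_set I.

Lemma max_notin_up I : (ord_max \in up_set I) = false.
Proof. by apply/negbTE/imsetP => -[i _ /eqP]; rewrite (negbTE (neq_lift _ _)). Qed.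

Lemma mem_up I i : (up i \in up_set I) = (i \in I).
Proof. exact: (mem_imset _ _ lift_inj). Qed.

Lemma max_in_cone I : ord_max \in cone_set I.
Proof. exact: setU11. Qed.

Lemma mem_cone I i : (up i \in cone_set I) = (i \in I).
Proof. by rewrite in_setU1 mem_up eq_sym (negbTE (neq_lift _ _)). Qed.

Lemma ord_maxP (P : 'I_n.+1 -> Prop) :
  P ord_max -> (forall i, P (up i)) -> forall i, P i.
Proof. by move=> Pm Pu i; case: (unliftP ord_max i) => [j|] ->. Qed.

Lemma setP_max (A B : {set 'I_n.+1}) :
  (ord_max \in A) = (ord_max \in B) ->
  (forall i, (up i \in A) = (up i \in B)) -> A = B.
Proof. by move=> AB0 AB; apply/setP; apply: ord_maxP. Qed.

Lemma set_up_or_cone (A : {set 'I_n.+1}) :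
  A = if ord_max \in A then cone_set (up @^-1: A) else up_set (up @^-1: A).
Proof.
by case: ifPn => [mA|/negbTE mA]; apply: setP_max => [|i];
   rewrite ?mA ?max_in_cone ?max_notin_up // ?mem_cone ?mem_up inE.
Qed.

Lemma up_setU I J : up_set (I :|: J) = up_set I :|: up_set J.
Proof. exact: imsetU. Qed.

Lemma up_setI I J : up_set (I :&: J) = up_set I :&: up_set J.
Proof. by apply: imsetI => i j _ _; apply: lift_inj. Qed.

Lemma cone_setT : cone_set setT = setT.
Proof. by apply: setP_max => [|i]; rewrite !inE ?eqxx // mem_up inE orbT. Qed.

Lemma sum_up x I : \sum_(i in up_set I) x 0 i = \sum_(i in I) x 0 (up i).
Proof. by rewrite big_imset //= => i j _ _; apply: lift_inj. Qed.

Lemma sum_cone x I :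
  \sum_(i in cone_set I) x 0 i = x 0 ord_max + \sum_(i in I) x 0 (up i).
Proof. by rewrite big_setU1 ?max_notin_up // sum_up. Qed.

(** The rank function of the slice of the polymatroid of [f] where the last
    coordinate is [t], and, for a set [I], the value [jump f I] of [t] beyond
    which the constraint on [I] comes from [cone_set I]. *)
Definition slice f (t : int) I := Num.min (f (up_set I)) (f (cone_set I) - t).
Definition jump f I := f (cone_set I) - f (up_set I).

(** Submodularity as decreasing marginal values.  It fixes the order of the
    jumps along a chain. *)
Lemma jump_le f I J : submodular f -> I \subset J -> jump f J <= jump f I.
Proof.
move=> [_ fS] /setUidPr IJ; have := fS (cone_set I) (up_set J).
have -> : cone_set I :|: up_set J = cone_set J.
  by apply: setP_max => [|i]; rewrite inE ?max_in_cone // !mem_cone mem_up -IJ !inE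
                                     orbA orbb.
have -> : cone_set I :&: up_set J = up_set I.
  apply: setP_max => [|i]; rewrite inE ?max_in_cone ?max_notin_up //.
  by rewrite mem_cone !mem_up -IJ inE; case: (i \in I).
by rewrite /jump; lia.
Qed.

Lemma submodular_slice f t : submodular f ->
  t <= jump f set0 -> submodular (slice f t).
Proof.
move=> [f0 fS] t_le; split=> [|I J].
  move: t_le; rewrite /slice /jump (_ : up_set set0 = set0) ?f0; first by lia.
  exact: imset0.
have UU := fS (up_set I) (up_set J).
have CU := fS (cone_set I) (up_set J).
have UC := fS (up_set I) (cone_set J).
have CC := fS (cone_set I) (cone_set J).
have eU : cone_set (I :|: J) = cone_set I :|: up_set J.
  by rewrite /cone_set up_setU setUA.
have eU' : cone_set (I :|: J) = up_set I :|: cone_set J.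
  by rewrite /cone_set up_setU setUCA.
have eUC : cone_set (I :|: J) = cone_set I :|: cone_set J.
  by rewrite /cone_set up_setU setUACA setUid.
have eI : up_set (I :&: J) = cone_set I :&: up_set J.
  by apply: setP_max => [|i]; rewrite inE ?max_notin_up ?andbF //
                                     mem_cone !mem_up inE.
have eI' : up_set (I :&: J) = up_set I :&: cone_set J.
  by apply: setP_max => [|i]; rewrite inE ?max_notin_up // mem_cone !mem_up inE.
have eIC : cone_set (I :&: J) = cone_set I :&: cone_set J.
  by rewrite /cone_set up_setI setUIr.
rewrite -up_setU -up_setI in UU; rewrite -eU -eI in CU; rewrite -eU' -eI' in UC.
rewrite -eUC -eIC in CC; rewrite /slice; lia.
Qed.

Definition extend a (t : int) : 'rV[int]_n.+1 :=
  \row_i oapp (fun j => a 0 j) t (unlift ord_max i).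

Lemma extend_max a t : extend a t 0 ord_max = t.
Proof. by rewrite mxE unlift_none. Qed.

Lemma extend_up a t i : extend a t 0 (up i) = a 0 i.
Proof. by rewrite mxE liftK. Qed.

Lemma row_ext_max x x' : x 0 ord_max = x' 0 ord_max ->
  (forall i, x 0 (up i) = x' 0 (up i)) -> x = x'.
Proof. by move=> e0 eu; apply/rowP; apply: ord_maxP. Qed.

(** The lower bound on [t] makes the constraint on the total the one coming from
    [cone_set setT]; below it, [slice f t] would have the wrong rank. *)
Lemma mem_extend f a t : jump f setT <= t ->
  (extend a t \in polymatroid f) = (a \in polymatroid (slice f t)).
Proof.
move=> t_ge; have su I : \sum_(i in I) extend a t 0 (up i) = \sum_(i in I) a 0 i.
  by apply: eq_bigr => i _; rewrite extend_up.
have sumT : \sum_(i < n.+1) extend a t 0 i = t + \sum_(i < n) a 0 i.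
  rewrite (bigD1_ord ord_max) //= extend_max; congr (_ + _).
  by apply: eq_bigr => i _; rewrite extend_up.
apply/polymatroidP/polymatroidP => -[xle xE]; split.
- move=> I; have := xle (up_set I); have := xle (cone_set I).
  by rewrite sum_up sum_cone extend_max su /slice; lia.
- move: t_ge xE; rewrite sumT -cone_setT /slice /jump; lia.
- move=> A; rewrite (set_up_or_cone A); move: (up @^-1: A) => I.
  have := xle I; rewrite /slice.
  by case: ifP => _; rewrite ?sum_up ?sum_cone su ?extend_max; lia.
- move: t_ge xE; rewrite sumT -cone_setT /slice /jump; lia.
Qed.

Lemma last_coord_bounds f x : x \in polymatroid f ->
  jump f setT <= x 0 ord_max <= jump f set0 + f set0.
Proof.
move=> /polymatroidP[xle xE].
have e0 : up_set set0 = set0 by exact: imset0.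
have := xle (up_set setT); have := xle (cone_set set0).
have : \sum_(i in cone_set setT) x 0 i = f (cone_set setT).
  by rewrite cone_setT -xE; apply: eq_bigl => i; rewrite inE.
rewrite !sum_cone sum_up big_set0 /jump e0; lia.
Qed.

Lemma extendD a b s t : extend a s + extend b t = extend (a + b) (s + t).
Proof.
by apply/rowP => i; rewrite !mxE; case: unlift => //= j; rewrite mxE.
Qed.

Lemma extendB a b s t : extend a s - extend b t = extend (a - b) (s - t).
Proof.
by apply/rowP => i; rewrite !mxE; case: unlift => //= j; rewrite !mxE.
Qed.

Lemma delta_up i : delta_mx 0 (up i) = extend (delta_mx 0 i) 0.
Proof.
apply: row_ext_max => [|j]; rewrite ?extend_max ?extend_up !mxE.
  by rewrite (negbTE (neq_lift _ _)).
by rewrite (inj_eq lift_inj).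
Qed.

Lemma ltn_up i j : (up i < up j)%N = (i < j)%N.
Proof. by rewrite !lift_max. Qed.

Lemma ltn_max i : (up i < @ord_max n)%N.
Proof. by rewrite lift_max ltn_ord. Qed.

Section Activity.
Variables (f : {set 'I_n.+1} -> int) (t : int).
Hypothesis t_ge : jump f setT <= t.
Implicit Types (i : 'I_n).

Lemma int_active_up a i :
  (up i \in int_active (polymatroid f) (extend a t)) =
  (i \in int_active (polymatroid (slice f t)) a).
Proof.
rewrite !inE; congr negb; apply/existsP/existsP => [[j] | [j /andP[lt_ji Pj]]].
  case: (unliftP ord_max j) => [k|] -> /andP[lt_ji].
    rewrite !delta_up extendB extendD subr0 addr0 mem_extend // => Pj.
    by exists k; rewrite -ltn_up lt_ji.
  by rewrite ltnNge ltnW ?ltn_max in lt_ji.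
exists (up j); rewrite ltn_up lt_ji /= !delta_up extendB extendD subr0 addr0.
by rewrite mem_extend.
Qed.

Lemma ext_active_up a i :
  (up i \in ext_active (polymatroid f) (extend a t)) =
  (i \in ext_active (polymatroid (slice f t)) a).
Proof.
rewrite !inE; congr negb; apply/existsP/existsP => [[j] | [j /andP[lt_ji Pj]]].
  case: (unliftP ord_max j) => [k|] -> /andP[lt_ji].
    rewrite !delta_up extendD extendB subr0 addr0 mem_extend // => Pj.
    by exists k; rewrite -ltn_up lt_ji.
  by rewrite ltnNge ltnW ?ltn_max in lt_ji.
exists (up j); rewrite ltn_up lt_ji /= !delta_up extendD extendB subr0 addr0.
by rewrite mem_extend.
Qed.

Hypothesis f_sub : submodular f.

(** If no unit can leave the last coordinate, the union of the blocking tight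
    sets is tight, and it is the set of all other indices: the last coordinate
    has its least possible value. *)
Lemma int_active_max a : a \in polymatroid (slice f t) ->
  (ord_max \in int_active (polymatroid f) (extend a t)) = (t == jump f setT).
Proof.
rewrite -mem_extend // => xP; rewrite inE negb_exists.
apply/forallP/eqP => [act|tE j].
  have blk i : exists A : {set 'I_n.+1},
      [&& tight f (extend a t) A, up i \in A & ord_max \notin A].
    by apply: (exchange_blocked xP); have := act (up i); rewrite ltn_max.
  have [B BP] := fin_all_exists blk.
  have tB : tight f (extend a t) (\bigcup_i B i).
    apply: (big_ind (tight f (extend a t))) => [|A A' tA tA'|i _].
    - by rewrite /tight big_set0 f_sub.1.
    - by case/andP: (tightUI f_sub xP tA tA').
    - by case/and3P: (BP i).
  have eB : \bigcup_i B i = up_set setT.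
    apply: setP_max => [|i].
      rewrite max_notin_up; apply/negbTE/bigcupP => -[i _].
      by apply/negP; case/and3P: (BP i).
    by rewrite mem_up inE; apply/bigcupP; exists i => //; case/and3P: (BP i).
  have [_ xE] := polymatroidP _ _ xP.
  have : \sum_(i in cone_set setT) extend a t 0 i = f (cone_set setT).
    by rewrite cone_setT -xE; apply: eq_bigl => i; rewrite inE.
  move: tB; rewrite eB /tight sum_up sum_cone extend_max /jump => /eqP; lia.
apply/negP => /andP[lt_j /last_coord_bounds/andP[+ _]].
rewrite !mxE unlift_none !eqxx (_ : (ord_max == j) = false) /= ?tE.
  by lia.
by apply/negbTE; rewrite -val_eqE /= neq_ltn lt_j orbT.
Qed.

(** Dually, intersections of tight sets. *)
Lemma ext_active_max a : a \in polymatroid (slice f t) ->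
  (ord_max \in ext_active (polymatroid f) (extend a t)) = (t == jump f set0).
Proof.
rewrite -mem_extend // => xP; rewrite inE negb_exists.
apply/forallP/eqP => [act|tE j].
  have blk i : exists A : {set 'I_n.+1},
      [&& tight f (extend a t) A, ord_max \in A & up i \notin A].
    apply: (exchange_blocked xP); have := act (up i).
    by rewrite ltn_max addrAC.
  have [B BP] := fin_all_exists blk.
  have tB : tight f (extend a t) (\bigcap_i B i).
    apply: (big_ind (tight f (extend a t))) => [|A A' tA tA'|i _].
    - have [_ xE] := polymatroidP _ _ xP; rewrite /tight -xE.
      by apply/eqP/eq_bigl => i; rewrite inE.
    - by case/andP: (tightUI f_sub xP tA tA').
    - by case/and3P: (BP i).
  have eB : \bigcap_i B i = cone_set set0.
    apply: setP_max => [|i].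
      by rewrite max_in_cone; apply/bigcapP => i _; case/and3P: (BP i).
    rewrite mem_cone inE; apply/negbTE/bigcapP => /(_ i isT).
    by apply/negP; case/and3P: (BP i).
  move: tB; rewrite eB /tight sum_cone big_set0 extend_max /jump => /eqP.
  by rewrite [up_set _]imset0 f_sub.1; lia.
apply/negP => /andP[lt_j /last_coord_bounds/andP[_]].
rewrite !mxE unlift_none !eqxx (_ : (ord_max == j) = false) /= ?tE ?f_sub.1.
  by lia.
by apply/negbTE; rewrite -val_eqE /= neq_ltn lt_j orbT.
Qed.
End Activity.

Lemma card_max (S : {set 'I_n.+1}) :
  #|S| = ((ord_max \in S) + #|[set i | up i \in S]|)%N.
Proof.
have cardE (m : nat) (A : {set 'I_m}) : #|A| = (\sum_(i < m) (i \in A))%N.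
  by rewrite -sum1_card big_mkcond.
rewrite !cardE (bigD1_ord ord_max) //=; congr (_ + _)%N.
by apply: eq_bigr => i _; rewrite inE.
Qed.

End Slices.

Definition activity_weight m (I E : {set 'I_m}) : {mpoly int[2]} :=
  'X_0 ^+ #|I :\: E| * 'X_1 ^+ #|E :\: I| * ('X_0 + 'X_1 - 1) ^+ #|I :&: E|.

Lemma activity_weight_max n (I E : {set 'I_n.+1}) :
  activity_weight I E =
    (1 + ('X_0 - 1) *+ (ord_max \in I) + ('X_1 - 1) *+ (ord_max \in E)) *
    activity_weight [set i | lift ord_max i \in I] [set i | lift ord_max i \in E].
Proof.
rewrite /activity_weight (card_max (I :\: E)) (card_max (E :\: I)).
rewrite (card_max (I :&: E)) !inE.
have -> : [set i | lift ord_max i \in I :\: E] =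
    [set i | lift ord_max i \in I] :\: [set i | lift ord_max i \in E].
  by apply/setP => i; rewrite !inE.
have -> : [set i | lift ord_max i \in E :\: I] =
    [set i | lift ord_max i \in E] :\: [set i | lift ord_max i \in I].
  by apply/setP => i; rewrite !inE.
have -> : [set i | lift ord_max i \in I :&: E] =
    [set i | lift ord_max i \in I] :&: [set i | lift ord_max i \in E].
  by apply/setP => i; rewrite !inE.
rewrite !exprD; case: (ord_max \in I); case: (ord_max \in E) => /=;
  rewrite ?expr0 ?expr1 ?mulr0n ?mulr1n; ring.
Qed.

(** The value of the last coordinate cuts the polymatroid into slices.  Passing
    from a slice to the polymatroid keeps the activities of the other indices,
    while the last index is internally (externally) active exactly on the
    lowest (highest) slice. *)
Lemma tutte_recursion n (f : {set 'I_n.+1} -> int) : submodular f ->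
  tutte (polymatroid f) =
    let T t := tutte (polymatroid (slice f t)) in
    let lo := jump f setT in let hi := jump f set0 in
    'X_0 * T lo + ('X_1 - 1) * T hi + (psum T hi - psum T lo).
Proof.
move=> fS; set T := fun t => _; cbv zeta.
set lo := jump f setT; set hi := jump f set0.
pose w x := activity_weight (int_active (polymatroid f) x)
                            (ext_active (polymatroid f) x).
pose W t := \sum_(x <- polymatroid f | x 0 ord_max == t) w x.
have le_lohi : lo <= hi by apply: jump_le (sub0set _).
have lohi x : x \in polymatroid f -> lo <= x 0 ord_max <= hi.
  by move/last_coord_bounds; rewrite fS.1 addr0.
have WE t : lo <= t <= hi ->
    W t = (1 + ('X_0 - 1) *+ (t == lo) + ('X_1 - 1) *+ (t == hi)) * T t.
  case/andP => t_ge t_le; rewrite /W -big_filter.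
  rewrite (perm_big [seq extend a t | a <- polymatroid (slice f t)]) /=.
    rewrite big_map /T /tutte big_distrr /= !big_seq; apply: eq_bigr => a aP.
    rewrite /w activity_weight_max int_active_max // ext_active_max //.
    have -> : [set i | lift ord_max i \in int_active (polymatroid f) (extend a t)]
        = int_active (polymatroid (slice f t)) a.
      by apply/setP => i; rewrite in_set int_active_up.
    have -> : [set i | lift ord_max i \in ext_active (polymatroid f) (extend a t)]
        = ext_active (polymatroid (slice f t)) a.
      by apply/setP => i; rewrite in_set ext_active_up.
    by [].
  apply: uniq_perm => [||x].
  - exact: filter_uniq (fset_uniq _).
  - rewrite map_inj_uniq ?fset_uniq // => a b ab; apply/rowP => i.
    by rewrite -(extend_up a t) ab extend_up.
  rewrite mem_filter; apply/andP/mapP => [[/eqP xt xP]|[a aP ->]].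
    have xE : x = extend (\row_i x 0 (lift ord_max i)) t.
      by apply: row_ext_max => [|i]; rewrite ?extend_max ?extend_up ?mxE.
    by exists (\row_i x 0 (lift ord_max i)); rewrite // -mem_extend // -xE.
  by rewrite extend_max eqxx; split=> //; rewrite mem_extend.
(* [W] equals [V] between [lo] and [hi]; [Phi] and [H] are explicit discrete
   primitives of [W] and [V]. *)
pose Phi t := \sum_(x <- polymatroid f | x 0 ord_max <= t) w x.
have PhiS t : Phi (t + 1) = W (t + 1) + Phi t.
  rewrite /Phi (bigID (fun x : 'rV__ => x 0 ord_max == t + 1)) /=.
  by congr (_ + _); apply: eq_bigl => x; move: (x 0 _) => u; lia.
have -> : tutte (polymatroid f) = Phi hi - Phi (lo - 1).
  rewrite [Phi (lo - 1)]big_seq_cond big1 ?subr0 => [|x]; last first.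
    by case/andP=> /lohi; lia.
  rewrite /Phi [RHS]big_seq_cond [LHS]big_seq; apply: eq_bigl => x.
  by case: (boolP (x \in _)) => //= /lohi/andP[].
rewrite -(psum_telescope _ _ PhiS).
clearbody T lo hi.
pose V t := (1 + ('X_0 - 1) *+ (t == lo) + ('X_1 - 1) *+ (t == hi)) * T t.
rewrite (psum_eq_in (h := V)); [|by lia|by move=> t ht; apply: WE; lia].
pose H t := psum T t + ('X_0 - 1) * T lo *+ (lo <= t)%R
                     + ('X_1 - 1) * T hi *+ (hi <= t)%R.
rewrite [LHS](psum_telescope (h := H)) => [|t].
  have lo_gt : (lo <= lo - 1) = false by lia.
  have hi_gt : (hi <= lo - 1) = false by lia.
  rewrite /H le_lohi lexx lo_gt hi_gt.
  have := psumS T (lo - 1); rewrite subrK => ->.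
  by rewrite !mulr0n !mulr1n; ring.
rewrite /H psumS /V.
have jumpS c (Q : {mpoly int[2]}) : Q * T c *+ (c <= t + 1)%R =
    Q *+ (t + 1 == c) * T (t + 1) + Q * T c *+ (c <= t)%R.
  have [<-|ne] := eqVneq (t + 1) c.
    by rewrite lexx (_ : (t + 1 <= t) = false) ?mulr0n ?mulr1n ?addr0 //; lia.
  by rewrite mulr0n mul0r add0r; congr (_ *+ _); move: ne; lia.
by rewrite !jumpS; ring.
Qed.
(** * Integer-valued polynomial functions *)

(** Being killed by any [d] successive differences characterizes integer-valued
    polynomial functions of degree less than [d] on a lattice, in any coordinates;
    in this form stability under affine substitution and summation is
    immediate. *)
Fixpoint deg_lt (M : zmodType) (d : nat) (F : M -> int) : Prop :=
  if d is d'.+1 then forall v, deg_lt d' (fun x => F (x + v) - F x)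
  else forall x, F x = 0.

Section FiniteDifferences.
Variable M : zmodType.
Implicit Types (F G : M -> int).

Lemma deg_lt_ext d F G : F =1 G -> deg_lt d F -> deg_lt d G.
Proof.
elim: d F G => [|d IH] F G FG /=; first by move=> F0 x; rewrite -FG.
by move=> dF v; apply: IH (dF v) => x; rewrite !FG.
Qed.

Lemma deg_lt0 d : deg_lt d (fun _ : M => 0).
Proof.
by elim: d => [|d IH] //= v; apply: deg_lt_ext IH => x; rewrite subrr.
Qed.

Lemma deg_ltS d F : deg_lt d F -> deg_lt d.+1 F.
Proof.
elim: d F => [|d IH] F dF v; last exact: IH.
by move=> x; rewrite !dF.
Qed.

Lemma deg_ltD d F G : deg_lt d F -> deg_lt d G -> deg_lt d (fun x => F x + G x).
Proof.
elim: d F G => [|d IH] F G dF dG; first by move=> x; rewrite dF dG.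
move=> v; apply: deg_lt_ext (IH _ _ (dF v) (dG v)) => x.
by rewrite opprD addrACA.
Qed.

Lemma deg_ltN d F : deg_lt d F -> deg_lt d (fun x => - F x).
Proof.
elim: d F => [|d IH] F dF; first by move=> x; rewrite dF.
by move=> v; apply: deg_lt_ext (IH _ (dF v)) => x; rewrite opprB addrC opprK.
Qed.

End FiniteDifferences.

Lemma deg_lt_affine (M M' : zmodType) (h : M' -> M) d (F : M -> int) :
    (forall v, exists w, forall x, h (x + v) = h x + w) ->
  deg_lt d F -> deg_lt d (fun x => F (h x)).
Proof.
move=> hA; elim: d F => [|d IH] F dF; first by move=> x; apply: dF.
by move=> v; have [w hw] := hA v; apply: deg_lt_ext (IH _ (dF w)) => x; rewrite hw.
Qed.

Lemma deg_lt_shift (M : zmodType) d (F : M -> int) v : 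
  deg_lt d F -> deg_lt d (fun x => F (x + v)).
Proof. by apply: deg_lt_affine => u; exists u => x; rewrite addrAC. Qed.
(** Summation raises the degree by one: a difference of [psum] in a direction
    [(s, v)] is the [psum] of a difference of [G] plus finitely many translates
    of [G]. *)
Lemma deg_lt_psum (M : zmodType) d (G : int * M -> int) :
  deg_lt d G -> deg_lt d.+1 (fun z : int * M => psum (fun t => G (t, z.2)) z.1).
Proof.
elim: d G => [|d IH] G dG.
  apply: deg_lt_ext (deg_lt0 _ _) => -[t f] /=.
  by rewrite (psum_uniq (h := fun _ => 0)) // => u; rewrite dG.
move=> [s v].
pose P (s : int) (z : int * M) :=
  psum (fun t => G (t, z.2 + v)) (z.1 + s) - psum (fun t => G (t, z.2 + v)) z.1.
have dP : deg_lt d.+1 (P s).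
  have dGv r : deg_lt d.+1 (fun z => G (z.1 + r, z.2 + v)).
    by apply: deg_lt_ext (deg_lt_shift (r, v) dG) => -[].
  elim/int_ind: s => [|n IHs|n IHs].
  - by apply: deg_lt_ext (deg_lt0 _ _) => z; rewrite /P addr0 subrr.
  - apply: deg_lt_ext (deg_ltD (dGv n.+1%:Z) IHs) => z.
    by rewrite /P (_ : z.1 + n.+1%:Z = z.1 + n%:Z + 1) ?psumS; [ring|lia].
  - apply: deg_lt_ext (deg_ltD (deg_ltN (dGv (- n%:Z))) IHs) => z.
    rewrite /P (_ : z.1 - n%:Z = z.1 - n.+1%:Z + 1); last by lia.
    by rewrite psumS; ring.
apply: deg_lt_ext (deg_ltD dP (IH _ (dG (0, v)))) => -[t f].
rewrite /P /= [RHS](_ : _ = psum (fun u => G (u, f + v)) (t + s) -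
  psum (fun u => G (u, f + v)) t + (psum (fun u => G (u, f + v)) t -
  psum (fun u => G (u, f)) t)); last by ring.
congr (_ + _); apply: (psum_uniq (h := fun t =>
  psum (fun u => G (u, f + v)) t - psum (fun u => G (u, f)) t)) => [|u].
  by rewrite /= !big_ord0.
have -> : (u + 1, f) + (0, v) = (u + 1, f + v) :> (int * M)%type
  by congr pair; rewrite addr0.
by rewrite !psumS; ring.
Qed.

(** * Polynomials supported on chains *)

Section Chains.
Variable n : nat.
Implicit Types (C : nat -> {set 'I_n}) (F : {ffun {set 'I_n} -> int} -> int).

(** Repetitions are allowed, so that every chain of sets from [set0] to [setT]
    can be indexed to end at [n]. *)
Definition chain C := [/\ C 0%N = set0, C n = setT & forall i, C i \subset C i.+1].

Definition supported C F :=
  forall f g : {ffun {set 'I_n} -> int}, (forall i, f (C i) = g (C i)) -> F f = F g.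

Lemma chain_sub C i j : chain C -> (i <= j)%N -> C i \subset C j.
Proof.
case=> _ _ CS /subnK <-; elim: (j - i)%N => [|k IH] //.
by rewrite addSn; apply: subset_trans IH (CS _).
Qed.
End Chains.

(** The shape kept by induction on [n]: a sum of terms [x ^ a * y ^ b * F (f)]
    where [F] is a polynomial function of the values of [f] along a single
    chain.  The last bound on [d] is what limits the denominators. *)
Inductive chain_poly n : ({ffun {set 'I_n} -> int} -> {mpoly int[2]}) -> Prop :=
| ChainPoly0 T : (forall f, T f = 0) -> chain_poly T
| ChainPolyD a b d C F T U : chain C -> supported C F -> deg_lt d.+1 F ->
    (a + b + d <= n)%N -> (d <= n.-1)%N -> chain_poly U ->
    (forall f, T f = 'X_0 ^+ a * 'X_1 ^+ b *~ F f + U f) -> chain_poly T.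

Section ChainPolyTheory.
Variable n : nat.
Implicit Types T U : {ffun {set 'I_n} -> int} -> {mpoly int[2]}.

Lemma chain_poly_ext T U : T =1 U -> chain_poly T -> chain_poly U.
Proof.
move=> TU cT; case: cT TU => [{}T T0 | a b d C F {}T V cC sF dF abd dn cV TE] TU.
  by apply: ChainPoly0 => f; rewrite -TU.
by apply: (ChainPolyD cC sF dF abd dn cV) => f; rewrite -TU.
Qed.

Lemma chain_polyD T U : chain_poly T -> chain_poly U ->
  chain_poly (fun f => T f + U f).
Proof.
move=> cT cU; elim: cT => [{}T T0 | a b d C F {}T V cC sF dF abd dn _ IH TE].
  by apply: chain_poly_ext cU => f; rewrite T0 add0r.
by apply: (ChainPolyD cC sF dF abd dn IH) => f; rewrite TE addrA.
Qed.

Lemma chain_poly_term a b d C F : chain C -> supported C F -> deg_lt d.+1 F ->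
    (a + b + d <= n)%N -> (d <= n.-1)%N ->
  chain_poly (fun f : {ffun {set 'I_n} -> int} => 'X_0 ^+ a * 'X_1 ^+ b *~ F f).
Proof.
move=> cC sF dF abd dn; apply: (ChainPolyD cC sF dF abd dn).
  exact: (@ChainPoly0 n (fun _ => 0)).
by move=> f; rewrite addr0.
Qed.

Lemma chain_poly_sum k (T : 'I_k -> {ffun {set 'I_n} -> int} -> {mpoly int[2]}) :
  (forall i, chain_poly (T i)) -> chain_poly (fun f => \sum_i T i f).
Proof.
elim: k T => [|k IH] T cT; first by apply: ChainPoly0 => f; rewrite big_ord0.
have := chain_polyD (cT ord0) (IH _ (fun i => cT (lift ord0 i))).
by apply: chain_poly_ext => f; rewrite big_ord_recl.
Qed.
End ChainPolyTheory.

Section ChainStep.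
Variable n : nat.
Local Notation rank := {ffun {set 'I_n} -> int}.
Local Notation rank1 := {ffun {set 'I_n.+1} -> int}.
Implicit Types (C : nat -> {set 'I_n}) (F : rank -> int) (g : rank1) (t : int).

(** The new element enters the chain right after position [j]: both
    [up_set (C j)] and [cone_set (C j)] occur, at positions [j] and [j.+1]. *)
Definition insert_chain C j i :=
  if (i <= j)%N then up_set (C i) else cone_set (C i.-1).

Lemma chain_insert C j : (j <= n)%N -> chain C -> chain (insert_chain C j).
Proof.
move=> le_jn cC; have [C0 Cn CS] := cC; split; rewrite /insert_chain.
- by rewrite leq0n C0; apply: imset0.
- by rewrite ltnNge le_jn /= Cn cone_setT.
move=> i; have [lt_ij|] := ltnP i j.
  by rewrite (ltnW lt_ij); apply: imsetS.
rewrite leq_eqVlt => /predU1P[<-|lt_ji].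
  by rewrite leqnn; apply: subsetUr.
rewrite leqNgt lt_ji /=; apply/setUS/imsetS.
by case: i lt_ji => // i _; apply: CS.
Qed.

(** On the part of the polymatroid where the last coordinate [t] lies between
    [jump g (C j.+1)] and [jump g (C j)], the rank function of the slice is
    affine in [(t, g)] along [C]. *)
Definition linear_slice (A : {set 'I_n}) (z : int * rank1) : rank :=
  [ffun I : {set 'I_n} =>
     if I \subset A then z.2 (up_set I) else z.2 (cone_set I) - z.1].

Lemma linear_sliceD A z v :
  linear_slice A (z + v) = linear_slice A z + linear_slice A v.
Proof.
apply/ffunP => I; rewrite !ffunE /=; case: ifP => _; rewrite ?ffunE //.
by rewrite opprD addrACA.
Qed.

Definition slice_rank g t : rank := [ffun I => slice g t I].

Lemma slice_linear C j g t : chain C -> submodular g ->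
  jump g (C j.+1) < t <= jump g (C j) ->
  forall i, slice_rank g t (C i) = linear_slice (C j) (t, g) (C i).
Proof.
move=> cC gS /andP[t_gt t_le] i; rewrite !ffunE /slice /=.
have [/(jump_le gS)|nsub] := boolP (C i \subset C j).
  by move: t_le; rewrite /jump; lia.
have lt_ji : (j < i)%N by rewrite ltnNge; apply: contra nsub; apply: chain_sub.
have /(jump_le gS) := chain_sub cC lt_ji.
by move: t_gt; rewrite /jump; lia.
Qed.

Definition slice_sum C F j k g :=
  psum (fun t => F (linear_slice (C j) (t, g))) (jump g (C k)).

Lemma deg_lt_slice_sum C F j k d : deg_lt d F -> deg_lt d.+1 (slice_sum C F j k).
Proof.
move=> dF; have dG : deg_lt d (fun z => F (linear_slice (C j) z)).
  by apply: deg_lt_affine dF => v; exists (linear_slice (C j) v) => x;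
     rewrite linear_sliceD.
apply: (deg_lt_affine (h := fun g => (jump g (C k), g))) (deg_lt_psum dG) => v.
exists (jump v (C k), v) => x; congr pair.
by rewrite /jump !ffunE opprD addrACA.
Qed.

Lemma chain_le_or_eq C i j : chain C -> C i \subset C j -> (i <= j)%N \/ C i = C j.
Proof.
move=> cC sij; case: (leqP i j) => [|lt_ji]; [by left | right].
by apply/eqP; rewrite eqEsubset sij chain_sub // ltnW.
Qed.

(** Summing over the block between two consecutive jumps produces boundary
    terms at each end; separately, each of them lives on a chain. *)
Lemma supported_slice_sum C F j k : chain C -> supported C F ->
  (j <= k <= j.+1)%N -> supported (insert_chain C k) (slice_sum C F j k).
Proof.
move=> cC sF /andP[le_jk le_kj] f g fg.
have fgU i : (i <= k)%N -> f (up_set (C i)) = g (up_set (C i)).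
  by move=> le_ik; have := fg i; rewrite /insert_chain le_ik.
have fgC i : (k <= i)%N -> f (cone_set (C i)) = g (cone_set (C i)).
  by move=> le_ki; have := fg i.+1; rewrite /insert_chain ltnNge le_ki.
have FE t : F (linear_slice (C j) (t, f)) = F (linear_slice (C j) (t, g)).
  apply: sF => i; rewrite !ffunE /=; case: ifPn => [sij|nsij].
    by case: (chain_le_or_eq cC sij) => [le_ij|->]; apply: fgU => //;
       apply: leq_trans le_jk.
  rewrite fgC //; apply: leq_trans le_kj _; rewrite ltnNge.
  by apply: contra nsij; apply: chain_sub.
by rewrite /slice_sum /jump fgU // fgC //; apply: eq_psum.
Qed.

(** The right-hand side of [tutte_recursion], with an arbitrary function [T] of
    the rank functions in place of the Tutte polynomial. *)
Definition recursion_step (T : rank -> {mpoly int[2]}) g :=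
  let lo := jump g setT in let hi := jump g set0 in
  'X_0 * T (slice_rank g lo) + ('X_1 - 1) * T (slice_rank g hi)
    + (psum (fun t => T (slice_rank g t)) hi
         - psum (fun t => T (slice_rank g t)) lo).

(** The two extreme slices contribute terms on the chains with the new element
    last, respectively first.  The remaining sum is cut at the jumps along
    [C]. *)
Lemma chain_poly_step_term a b d C F : chain C -> supported C F ->
    deg_lt d.+1 F -> (a + b + d <= n)%N -> (d <= n.-1)%N ->
  exists2 U : rank1 -> {mpoly int[2]}, chain_poly U &
    forall g, submodular g ->
      recursion_step (fun f => 'X_0 ^+ a * 'X_1 ^+ b *~ F f) g = U g.
Proof.
move=> cC sF dF abd dn; pose P : {mpoly int[2]} := 'X_0 ^+ a * 'X_1 ^+ b.
have [C0 Cn CS] := cC.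
pose lo_rank g : rank := [ffun I => g (up_set I)].
pose hi_rank g : rank := [ffun I => g (cone_set I) - jump g set0].
pose U1 g := 'X_0 ^+ a.+1 * 'X_1 ^+ b *~ F (lo_rank g) : {mpoly int[2]}.
pose U2 g := 'X_0 ^+ a * 'X_1 ^+ b.+1 *~ F (hi_rank g) : {mpoly int[2]}.
pose U3 g := P *~ (- F (hi_rank g)).
pose S1 (j : 'I_n) g := P *~ slice_sum C F j j g.
pose S2 (j : 'I_n) g := P *~ (- slice_sum C F j j.+1 g).
exists (fun g => U1 g + (U2 g + (U3 g + (\sum_j S1 j g + \sum_j S2 j g)))).
  have d_le : (d <= n.+1.-1)%N by lia.
  have s_lo : supported (insert_chain C n) (fun g => F (lo_rank g)).
    move=> f g fg; apply: sF => i; rewrite !ffunE.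
    have [le_in|lt_ni] := leqP i n.
      by have := fg i; rewrite /insert_chain le_in.
    suff -> : C i = C n by have := fg n; rewrite /insert_chain leqnn.
    by apply/eqP; rewrite eqEsubset {1}Cn subsetT chain_sub // ltnW.
  have s_hi : supported (insert_chain C 0) (fun g => F (hi_rank g)).
    move=> f g fg; apply: sF => i; rewrite !ffunE /jump.
    have := fg i.+1; rewrite /insert_chain /= => ->.
    by have := fg 1%N; have := fg 0%N; rewrite /insert_chain /= C0 => -> ->.
  have d_hi : deg_lt d.+1 (fun g => F (hi_rank g)).
    apply: deg_lt_affine dF => v; exists (hi_rank v) => x; apply/ffunP => I.
    by rewrite !ffunE /jump !ffunE; ring.
  have cC_lo := chain_insert (leqnn n) cC; have cC_hi := chain_insert (leq0n n) cC.
  apply: chain_polyD.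
    apply: (chain_poly_term (d := d) cC_lo s_lo) => //.
    apply: deg_lt_affine dF => v; exists (lo_rank v) => x; apply/ffunP => I.
    by rewrite !ffunE.
  apply: chain_polyD; first by apply: (chain_poly_term (d := d) cC_hi s_hi) => //; lia.
  apply: chain_polyD.
    apply: (chain_poly_term cC_hi _ (deg_ltN d_hi)) => //; last by lia.
    by move=> f g /s_hi ->.
  have d_S (j : 'I_n) k : deg_lt d.+2 (slice_sum C F j k) by apply: deg_lt_slice_sum.
  apply: chain_polyD; apply: chain_poly_sum => j; have lt_jn := ltn_ord j.
    have s_S := supported_slice_sum (k := j) cC sF _.
    apply: (chain_poly_term (chain_insert (ltnW lt_jn) cC) (s_S _ _) (d_S _ _));
      lia.
  have s_S := supported_slice_sum (k := j.+1) cC sF _.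
  apply: (chain_poly_term (chain_insert lt_jn cC) _ (deg_ltN (d_S j j.+1)));
    try lia.
  by move=> f g /s_S ->; lia.
move=> g gS; rewrite /recursion_step.
have le_lohi : jump g setT <= jump g set0 by apply: jump_le (sub0set _).
have -> : F (slice_rank g (jump g setT)) = F (lo_rank g).
  apply: sF => i; rewrite !ffunE /slice.
  by have /(jump_le gS) := subsetT (C i); rewrite {2}/jump; lia.
have -> : F (slice_rank g (jump g set0)) = F (hi_rank g).
  apply: sF => i; rewrite !ffunE /slice.
  by have /(jump_le gS) := sub0set (C i); rewrite {1}/jump; lia.
have -> : psum (fun t => P *~ F (slice_rank g t)) (jump g set0)
        - psum (fun t => P *~ F (slice_rank g t)) (jump g setT)
      = \sum_j S1 j g + \sum_j S2 j g.
  (* The telescoping sum over the blocks between consecutive jumps. *)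
  pose B i := - psum (fun t => P *~ F (slice_rank g t)) (jump g (C i)).
  transitivity (B n - B 0%N); first by rewrite /B C0 Cn opprK addrC.
  rewrite -telescope_sumr // big_mkord -big_split; apply: eq_bigr => j _ /=.
  rewrite /B opprK [LHS]addrC (psum_eq_in (h := fun t =>
    P *~ F (linear_slice (C j) (t, g)))); first last.
  - by move=> t ht; congr (_ *~ _); apply: sF; apply: slice_linear.
  - by apply: jump_le.
  by rewrite !psum_mulrz /S1 /S2 /slice_sum mulrNz.
rewrite !addrA /U1 /U2 /U3 /P; congr (_ + _ + _).
rewrite !mulrzAr !exprS mulrNz -addrA; congr (_ *~ _ + _).
  by rewrite mulrA.
by rewrite -mulrzBl mulrBl mul1r mulrCA.
Qed.
Lemma chain_poly_step T : chain_poly T ->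
  exists2 U : rank1 -> {mpoly int[2]}, chain_poly U &
    forall g, submodular g -> recursion_step T g = U g.
Proof.
elim=> [{}T T0 | a b d C F {}T V cC sF dF abd dn _ [U cU UE] TE].
  exists (fun _ => 0) => [|g _]; first exact: ChainPoly0.
  have psum0 t : psum (fun t => T (slice_rank g t)) t = 0.
    by apply: (psum_uniq (h := fun _ => 0)) => // u; rewrite T0 addr0.
  by rewrite /recursion_step !T0 !mulr0 !psum0 subrr !addr0.
have [W cW WE] := chain_poly_step_term cC sF dF abd dn.
exists (fun g => W g + U g) => [|g gS]; first exact: chain_polyD.
rewrite -WE // -UE // /recursion_step !TE !mulrDr.
rewrite !(eq_psum (fun t => TE (slice_rank g t))) !psumD.
by rewrite [RHS]addrACA; congr (_ + _); rewrite ?opprD addrACA.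
Qed.
End ChainStep.

Lemma polymatroid_eq n (f g : {set 'I_n} -> int) :
  f =1 g -> polymatroid f = polymatroid g.
Proof.
move=> fg; apply/fsetP => x.
by apply/polymatroidP/polymatroidP => -[xle xE]; split=> [I|];
  rewrite -?fg ?xE // ?fg.
Qed.

Lemma submodular_eq n (f g : {set 'I_n} -> int) :
  f =1 g -> submodular f -> submodular g.
Proof. by move=> fg [f0 fS]; split=> [|I J]; rewrite -!fg. Qed.

Lemma tutte_0 (f : {set 'I_0} -> int) : submodular f -> tutte (polymatroid f) = 1.
Proof.
move=> fS; have e0 (A : {set 'I_0}) : A = set0 by apply/setP => -[].
have eP : polymatroid f = [fset 0]%fset.
  apply/fsetP => x; rewrite in_fset1; have -> : x = 0 by apply/rowP => -[].
  rewrite eqxx; apply/polymatroidP; split=> [I|].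
    by rewrite (e0 I) big_set0 fS.1.
  by rewrite big_ord0 (e0 setT) fS.1.
rewrite eP /tutte big_seq_fset1 !(e0 (_ :\: _)) (e0 (_ :&: _)) cards0.
by rewrite !expr0 !mul1r.
Qed.

Lemma tutte_chain_poly n : exists2 U, chain_poly U &
  forall f : {ffun {set 'I_n} -> int}, submodular f -> tutte (polymatroid f) = U f.
Proof.
elim: n => [|n [T cT TE]].
  exists (fun _ => 'X_0 ^+ 0 * 'X_1 ^+ 0 *~ 1) => [|f /tutte_0 -> //].
    apply: (@chain_poly_term 0 0 0 0 (fun _ => set0) (fun _ => 1)) => //.
      by split=> //; apply/setP => -[].
  by rewrite !expr0 mul1r mulr1z.
have [U cU UE] := chain_poly_step cT; exists U => // f fS.
have lo_hi : jump f setT <= jump f set0 by apply: jump_le (sub0set _).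
have E t : t <= jump f set0 -> tutte (polymatroid (slice f t)) = T (slice_rank f t).
  move=> t_le; have e := ffunE (slice f t).
  rewrite -TE; first by rewrite (polymatroid_eq e).
  by apply: submodular_eq (submodular_slice fS t_le) => I; rewrite e.
rewrite -UE // tutte_recursion //= /recursion_step !E //; congr (_ + _).
by apply: psum_eq_in => // t /andP[_ t_le]; apply: E.
Qed.

(** * From polynomial functions to polynomials with controlled denominators *)

Section Newton.
Variable M : zmodType.
Implicit Types (F : M -> int) (v x : M).

Definition difference v F x := F (x + v) - F x.

Lemma deg_lt_difference v d F j :
  deg_lt d F -> deg_lt (d - j) (iter j (difference v) F).
Proof.
elim: j d F => [|j IH] [|d] F dF //; rewrite ?subn0 //.
  by rewrite iterSr; apply: (IH 0%N) => x; rewrite /difference !dF subrr.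
by rewrite iterSr subSS; apply: IH (dF v).
Qed.

Definition binomial_rat (r : rat) j := (j`!%:R)^-1 * \prod_(i < j) (r - i%:R).

Lemma binomial_rat0 j : binomial_rat 0 j = (j == 0%N)%:R.
Proof.
rewrite /binomial_rat; case: j => [|j]; first by rewrite big_ord0 invr1 mul1r.
by rewrite big_ord_recl subrr mul0r mulr0.
Qed.

Lemma binomial_ratS r j :
  binomial_rat (r + 1) j.+1 = binomial_rat r j + binomial_rat r j.+1.
Proof.
rewrite /binomial_rat [in LHS]big_ord_recl [X in _ + _ * X]big_ord_recr /=.
have -> : \prod_(i < j) (r + 1 - (lift ord0 i)%:R) = \prod_(i < j) (r - i%:R).
  by apply: eq_bigr => i _; rewrite lift0 -addn1 natrD; ring.
rewrite factS natrM; have : j`!%:R != 0 :> rat by rewrite pnatr_eq0 -lt0n fact_gt0.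
have : j.+1%:R != 0 :> rat by rewrite pnatr_eq0.
rewrite -[j.+1]addn1 natrD; move: (\prod_(i < j) _) => P nz1 nz2; field.
by rewrite nz1 nz2.
Qed.

(** Newton's interpolation formula along the line through [x] of direction
    [v]. *)
Lemma newton d F v x t : deg_lt d F ->
  (F (x + v *~ t))%:~R =
    \sum_(j < d) binomial_rat t%:~R j * (iter j (difference v) F x)%:~R.
Proof.
elim: d F x t => [|d IH] F x t dF; first by rewrite big_ord0 dF.
pose N (u : int) := \sum_(j < d.+1)
  binomial_rat u%:~R j * (iter j (difference v) F x)%:~R.
apply/eqP; rewrite -subr_eq0; apply/eqP.
pose D u : rat := (F (x + v *~ u))%:~R - N u.
suff /(_ t 0) : forall s u, D s = D u.
  rewrite /D => ->; rewrite mulr0z addr0 /N big_ord_recl binomial_rat0 mul1r.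
  rewrite big1 ?addr0 ?subrr // => j _.
  by rewrite binomial_rat0 mul0r.
apply: constant_int => u; apply/eqP; rewrite -subr_eq0; apply/eqP.
transitivity ((F (x + v *~ (u + 1)) - F (x + v *~ u))%:~R - (N (u + 1) - N u)).
  by rewrite /D rmorphB /=; ring.
have -> : x + v *~ (u + 1) = x + v *~ u + v by rewrite mulrzDr addrA.
have FE : (F (x + v *~ u + v) - F (x + v *~ u))%:~R = _ :> rat := IH _ x u (dF v).
rewrite FE.
suff -> : N (u + 1) - N u = \sum_(j < d) binomial_rat u%:~R j *
    (iter j (difference v) (difference v F) x)%:~R by rewrite subrr.
have b0 r : binomial_rat r 0 = 1 by rewrite /binomial_rat big_ord0 invr1 mulr1.
rewrite /N !big_ord_recl /= !b0 opprD addrACA -sumrB subrr add0r.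
apply: eq_bigr => j _; rewrite -mulrBl /bump /= add1n rmorphD /= binomial_ratS.
by rewrite addrK -iterS iterSr.
Qed.
End Newton.

Section MpolyDegree.
Variable m : nat.
Implicit Types p q : {mpoly rat[m]}.

Lemma msize_mul_le a b p q :
  (msize p <= a.+1)%N -> (msize q <= b.+1)%N -> (msize (p * q) <= (a + b).+1)%N.
Proof.
have [->|nz_p] := eqVneq p 0; first by rewrite mul0r msize0.
have [->|nz_q] := eqVneq q 0; first by rewrite mulr0 msize0.
by rewrite msizeM //; move: (msize p) (msize q) => k l; lia.
Qed.

Lemma msize_sum_le (I : finType) a (p : I -> {mpoly rat[m]}) :
  (forall i, msize (p i) <= a)%N -> (msize (\sum_i p i) <= a)%N.
Proof.
move=> pa; apply: (big_ind (fun q => msize q <= a)%N) => // [|q r qa ra].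
  by rewrite msize0.
by apply: leq_trans (msizeD_le _ _) _; rewrite geq_max qa.
Qed.

Lemma msize_prod_le k (c : 'I_k -> nat) (p : 'I_k -> {mpoly rat[m]}) :
  (forall i, msize (p i) <= (c i).+1)%N -> (msize (\prod_i p i) <= (\sum_i c i).+1)%N.
Proof.
move=> pc; elim/big_ind2: _ => // [|q a r b]; last exact: msize_mul_le.
by rewrite msize1.
Qed.

Definition integral p := exists q : {mpoly int[m]}, p = map_mpoly intr q.

Lemma integralC (c : int) : integral (c%:~R)%:MP.
Proof. by exists c%:MP; rewrite map_mpolyC. Qed.

Lemma integralX i : integral 'X_i.
Proof. by exists 'X_i; rewrite map_mpolyX. Qed.

Lemma integralD p q : integral p -> integral q -> integral (p + q).
Proof. by case=> p' -> [q' ->]; exists (p' + q'); rewrite rmorphD. Qed.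

Lemma integralM p q : integral p -> integral q -> integral (p * q).
Proof. by case=> p' -> [q' ->]; exists (p' * q'); rewrite rmorphM. Qed.

Lemma integralZ (c : int) p : integral p -> integral (c%:~R *: p).
Proof. by move=> Ip; rewrite -mul_mpolyC; apply: integralM Ip; apply: integralC. Qed.

Lemma integral_sum (I : finType) (p : I -> {mpoly rat[m]}) :
  (forall i, integral (p i)) -> integral (\sum_i p i).
Proof.
move=> Ip; apply: big_ind => // [|q r]; last exact: integralD.
by exists 0; rewrite rmorph0.
Qed.

Lemma integral_prod (I : finType) (p : I -> {mpoly rat[m]}) :
  (forall i, integral (p i)) -> integral (\prod_i p i).
Proof.
move=> Ip; apply: big_ind => // [|q r]; last exact: integralM.
by exists 1; rewrite rmorph1.
Qed.

Lemma integral_mpolyOver p : integral p -> p \is a mpolyOver m Num.int.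
Proof. by case=> q ->; apply/mpolyOverP => k; rewrite mcoeff_map_mpoly intr_int. Qed.
End MpolyDegree.

Section DegLtMpoly.
Variables (V : finType) (m : nat) (phi : V -> {mpoly rat[m]}).
Hypothesis phi_deg : forall v, (msize (phi v) <= 2)%N.
Hypothesis phi_int : forall v, integral (phi v).
Local Notation M := {ffun V -> int}.

Definition axis v : M := [ffun u => (u == v)%:R].
Definition erase v (f : M) : M := [ffun u => if u == v then 0 else f u].

Lemma erase_axis v (f : M) : f = erase v f + axis v *~ f v.
Proof.
have axisM z u : (axis v *~ z) u = (u == v)%:R * z.
  elim/int_ind: z => [|k IH|k IH]; first by rewrite mulr0z ffunE mulr0.
    by rewrite intS mulrzDr mulr1z ffunE IH ffunE; ring.
  by rewrite intS opprD mulrzDr mulrNz mulr1z ffunE IH !ffunE; ring.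
apply/ffunP => u; rewrite !ffunE axisM.
by have [->|_] := eqVneq; rewrite ?mul1r ?mul0r ?add0r ?addr0.
Qed.

Definition supported_on (s : seq V) (F : M -> int) :=
  forall f g : M, {in s, f =1 g} -> F f = F g.

Lemma supported_on_difference s v (F : M -> int) j :
  supported_on s F -> supported_on s (iter j (difference v) F).
Proof.
elim: j => [//|j IH] /IH{}IH f g fg /=; rewrite /difference (IH _ _ fg).
by congr (_ - _); apply: IH => u /fg E; rewrite !ffunE E.
Qed.

Definition binomial_mpoly j (p : {mpoly rat[m]}) :=
  (j`!%:R)^-1 *: \prod_(i < j) (p - i%:R%:MP).

Lemma msize_phiB v (c : rat) : (msize (phi v - c%:MP) <= 2)%N.
Proof.
rewrite -mpolyCN; apply: leq_trans (msizeD_le _ _) _.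
by rewrite geq_max phi_deg msizeC; case: (_ == _).
Qed.

(** Newton's formula, one variable at a time.  Each variable [v] is sent to
    [phi v]; the denominators are products [j! (d - j)!], which divide [d!]. *)
Lemma deg_lt_mpoly (s : seq V) d F : deg_lt d.+1 F -> supported_on s F ->
  exists p : {mpoly rat[m]},
    [/\ (msize p <= d.+1)%N, integral (d`!%:R *: p) &
      forall w (f : M), (forall v, (phi v).@[w] = (f v)%:~R) ->
        p.@[w] = (F f)%:~R].
Proof.
elim: s d F => [|v s IH] d F dF sF.
  exists ((F 0)%:~R)%:MP; split=> [||w f _]; last by rewrite mevalC (sF f 0).
    by rewrite msizeC; case: (_ == _).
  by rewrite -[_`!%:R]/(_`!%:Z%:~R); apply/integralZ/integralC.
have step (j : 'I_d.+1) : exists p : {mpoly rat[m]},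
    [/\ (msize p <= (d - j).+1)%N, integral ((d - j)`!%:R *: p) &
      forall w (f : M), (forall v, (phi v).@[w] = (f v)%:~R) ->
        p.@[w] = (iter j (difference (axis v)) F (erase v f))%:~R].
  have le_jd : (j <= d)%N by rewrite -ltnS.
  apply: IH.
    apply: (deg_lt_affine (h := erase v)); last first.
      by rewrite -subSn //; apply: deg_lt_difference.
    move=> g; exists (erase v g) => f; apply/ffunP => u; rewrite !ffunE.
    by case: eqP => _; rewrite ?addr0.
  move=> f g fg; apply: (supported_on_difference (axis v) j sF) => u.
  by rewrite inE !ffunE; have [//|_ /fg] := eqVneq.
have [p pP] := fin_all_exists step.
exists (\sum_(j < d.+1) binomial_mpoly j (phi v) * p j); split.
- apply: msize_sum_le => j; have le_jd : (j <= d)%N by rewrite -ltnS.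
  rewrite -{2}(subnKC le_jd); apply: msize_mul_le; last by case: (pP j).
  apply: leq_trans (msizeZ_le _ _) _.
  have := @msize_prod_le m j (fun _ => 1%N) (fun i => phi v - i%:R%:MP).
  by rewrite sum1_card card_ord; apply=> i; apply: msize_phiB.
- rewrite scaler_sumr; apply: integral_sum => j.
  have le_jd : (j <= d)%N by rewrite -ltnS.
  have nz_j : j`!%:R != 0 :> rat by rewrite pnatr_eq0 -lt0n fact_gt0.
  have -> : d`!%:R *: (binomial_mpoly j (phi v) * p j) =
      'C(d, j)%:R *: (\prod_(i < j) (phi v - i%:R%:MP)) * ((d - j)`!%:R *: p j).
    rewrite /binomial_mpoly -!scalerAl -scalerAr !scalerA; congr (_ *: _).
    by rewrite -(bin_fact le_jd) !natrM; field.
  apply: integralM; last by case: (pP j).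
  apply: (integralZ 'C(d, j)); apply: integral_prod => i.
  apply: integralD => //; rewrite -mpolyCN.
  have -> : - i%:R = (- i%:Z)%:~R :> rat by rewrite rmorphN.
  exact: integralC.
- move=> w f wf; rewrite rmorph_sum [in RHS](erase_axis v f) /= (newton _ _ _ dF).
  apply: eq_bigr => j _; rewrite mevalM; congr (_ * _); last first.
    by case: (pP j) => _ _; apply.
  rewrite /binomial_mpoly /binomial_rat mevalZ rmorph_prod /=; congr (_ * _).
  by apply: eq_bigr => i _; rewrite mevalB mevalC wf.
Qed.
End DegLtMpoly.

(** * Polynomials are determined by their values *)

Lemma poly_nat_roots (P : {poly rat}) (n0 : nat) :
  (forall t : nat, (n0 <= t)%N -> P.[t%:R] = 0) -> P = 0.
Proof.
move=> P0; apply: (@roots_geq_poly_eq0 _ P [seq i%:R | i <- iota n0 (size P)]).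
- by apply/allP => _ /mapP[i + ->]; rewrite mem_iota => /andP[/P0 /eqP].
- rewrite map_inj_uniq ?iota_uniq // => i j /eqP.
  by rewrite eqr_nat => /eqP.
- by rewrite size_map size_iota.
Qed.

Section Curves.
Variables (m : nat) (c : 'I_m -> {poly rat}).
Implicit Types p : {mpoly rat[m]}.

Definition restrict_to_curve p : {poly rat} := mmap polyC c p.

Lemma horner_curve p t : (restrict_to_curve p).[t] = p.@[fun i => (c i).[t]].
Proof.
rewrite /restrict_to_curve mevalE /mmap horner_sum; apply: eq_bigr => k _.
rewrite hornerM hornerC /mmap1 horner_prod; congr (_ * _).
by apply: eq_bigr => i _; rewrite horner_exp.
Qed.

Lemma size_curve p : (forall i, size (c i) <= 2)%N ->
  (size (restrict_to_curve p) <= msize p)%N.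
Proof.
move=> c2; rewrite /restrict_to_curve /mmap big_seq.
apply: (big_ind (fun q : {poly rat} => size q <= msize p)%N) => [|q r qp rp|k kp].
- by rewrite size_poly0.
- by apply: leq_trans (size_polyD _ _) _; rewrite geq_max qp.
rewrite mul_polyC; apply: leq_trans (size_scale_leq _ _) _.
apply: leq_trans (msize_mdeg_lt kp); rewrite mdegE /mmap1.
elim/big_ind2: _ => [|P a Q b Pa Qb|i _]; first by rewrite size_poly1.
  by apply: leq_trans (size_polyMleq _ _) _; lia.
elim: (k i) => [|e IH]; first by rewrite expr0 size_poly1.
rewrite exprS; apply: leq_trans (size_polyMleq _ _) _.
by have := c2 i; lia.
Qed.
End Curves.

Lemma digits_inj B m (a b : 'I_m -> nat) :
    (forall i, a i < B)%N -> (forall i, b i < B)%N ->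
  (\sum_i a i * B ^ i)%N = (\sum_i b i * B ^ i)%N -> a =1 b.
Proof.
elim: m a b => [|m IH] a b aB bB; first by move=> _ [].
have shift (e : 'I_m.+1 -> nat) : (\sum_i e i * B ^ i)%N =
    ((\sum_(i < m) e (lift ord0 i) * B ^ i) * B + e ord0)%N.
  rewrite big_ord_recl expn0 muln1 addnC big_distrl; congr addn.
  by apply: eq_bigr => i _; rewrite /= /bump add1n expnSr mulnA.
rewrite !shift => E; have e0 : a ord0 = b ord0.
  by have := congr1 (modn^~ B) E; rewrite !modnMDl !modn_small.
have B0 : (0 < B)%N by apply: leq_trans (aB ord0).
have /IH eS : (\sum_(i < m) a (lift ord0 i) * B ^ i =
               \sum_(i < m) b (lift ord0 i) * B ^ i)%N.
  by move/eqP: E; rewrite e0 eqn_add2r eqn_pmul2r // => /eqP.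
by move=> i; case: (unliftP ord0 i) => [j|] -> //; apply: eS.
Qed.

(** Kronecker substitution: along the curve [t |-> (t ^ B ^ i)_i], with [B]
    larger than the degree of [p], distinct monomials of [p] become distinct
    powers of [t]. *)
Lemma mpoly_nat_eval0 m (p : {mpoly rat[m]}) :
  (forall w : 'I_m -> nat, p.@[fun i => (w i)%:R] = 0) -> p = 0.
Proof.
move=> p0; pose B := msize p.
pose c (i : 'I_m) : {poly rat} := 'X ^+ (B ^ i).
have curve0 : restrict_to_curve c p = 0.
  apply: (@poly_nat_roots _ 0) => t _; rewrite horner_curve.
  rewrite -[RHS](p0 (fun i => t ^ (B ^ i))%N); apply: meval_eq => i.
  by rewrite /c horner_exp hornerX natrX.
pose kron (k : 'X_{1..m}) := (\sum_i k i * B ^ i)%N.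
have curveE : restrict_to_curve c p = \sum_(k <- msupp p) p@_k *: 'X^(kron k).
  apply: eq_bigr => k _; rewrite mul_polyC /mmap1 /kron; congr (_ *: _).
  rewrite (big_morph _ (exprD ('X : {poly rat})) (expr0 _)).
  by apply: eq_bigr => i _; rewrite /c -exprM mulnC.
have kB (k : 'X_{1..m}) i : k \in msupp p -> (k i < B)%N.
  move=> /msize_mdeg_lt; apply: leq_ltn_trans.
  by rewrite mdegE (bigD1 i) //= leq_addr.
apply/mpolyP => k; rewrite mcoeff0; apply/eqP; apply: contraT => pk.
have kp : k \in msupp p by rewrite mcoeff_msupp.
move: curve0; rewrite curveE => /(congr1 (fun q : {poly rat} => q`_(kron k))).
rewrite coef0 coef_sum (bigD1_seq k) ?msupp_uniq //= coefZ coefXn eqxx mulr1.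
rewrite big_seq_cond big1 ?addr0 => [/eqP|l /andP[lp nlk]].
  by rewrite (negbTE pk).
rewrite coefZ coefXn; case: eqP => [/digits_inj e|_]; last by rewrite mulr0.
case/eqP: nlk; apply/mnmP => i; apply/esym/e => j; exact: kB.
Qed.

(** * The universal polynomial *)

Section Universal.
Variable n : nat.
Local Notation N := #|var n|.
Implicit Types (f : {set 'I_n} -> int) (v : 'I_2 -> rat) (T : {mpoly rat[N]}).

Definition xy_index (i : 'I_2) : 'I_N := enum_rank (inl i : var n).

Definition z_mpoly (I : {set 'I_n}) : {mpoly rat[N]} :=
  if insub I is Some J then 'X_(enum_rank (inr J : var n)) else 0.

Definition specialization_point v f (k : 'I_N) : rat :=
  match enum_val k with inl i => v i | inr J => (f (val J))%:~R end.

Lemma point_xy v f i : specialization_point v f (xy_index i) = v i.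
Proof. by rewrite /specialization_point enum_rankK. Qed.

Lemma meval_z v f I :
  f set0 = 0 -> (z_mpoly I).@[specialization_point v f] = (f I)%:~R.
Proof.
move=> f0; rewrite /z_mpoly; case: insubP => [J _ <-|].
  by rewrite mevalXU /specialization_point enum_rankK.
by rewrite negbK => /eqP ->; rewrite meval0 f0.
Qed.

Lemma meval_specialize v f T :
  (specialize f T).@[v] = T.@[specialization_point v f].
Proof.
rewrite /specialize comp_mpoly_meval; apply: meval_eq => k.
rewrite tnth_mktuple /specialization_point; case: (enum_val k) => [i|J].
  exact: mevalXU.
exact: mevalC.
Qed.

(** A denominator [d!] with [d <= n - 1] divides [(n - 1)!]. *)
Lemma chain_poly_mpoly U : chain_poly U -> exists T,
  [/\ (msize T <= n.+1)%N, integral (n.-1`!%:R *: T) &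
    forall v (f : {ffun {set 'I_n} -> int}), f set0 = 0 ->
      T.@[specialization_point v f] = (map_mpoly intr (U f)).@[v]].
Proof.
elim=> [{}U U0 | a b d C F {}U V cC sF dF abd dn _ [T [Tn Tint TE]] UE].
  exists 0; split=> [||v f f0]; first by rewrite msize0.
    by rewrite scaler0; exists 0; rewrite rmorph0.
  by rewrite U0 !rmorph0.
have z_deg I : (msize (z_mpoly I) <= 2)%N.
  by rewrite /z_mpoly; case: insub => [J|]; rewrite ?msize0 // msizeX mdeg1.
have z_int I : integral (z_mpoly I).
  by rewrite /z_mpoly; case: insub => [J|]; [apply: integralX |];
     exists 0; rewrite rmorph0.
have sF' : supported_on (enum {set 'I_n}) F.
  by move=> f g fg; apply: sF => i; apply: fg; rewrite mem_enum.
have [p [pd pint pE]] := deg_lt_mpoly z_deg z_int dF sF'.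
pose X i : {mpoly rat[N]} := 'X_(xy_index i).
have X_deg i e : (msize (X i ^+ e) <= e.+1)%N.
  by rewrite /X mpolyXn msizeX mdegMn mdeg1 mul1n.
have X_int i e : integral (X i ^+ e).
  elim: e => [|e IH]; first by exists 1; rewrite rmorph1.
  by rewrite exprS; apply: integralM IH; apply: integralX.
exists (X 0 ^+ a * X 1 ^+ b * p + T); split.
- apply: leq_trans (msizeD_le _ _) _; rewrite geq_max Tn andbT.
  have := msize_mul_le (msize_mul_le (X_deg 0 a) (X_deg 1 b)) pd.
  by move/leq_trans; apply.
- rewrite scalerDr; apply: integralD Tint.
  have /dvdnP[k ->] : (d`! %| n.-1`!)%N.
    by rewrite (fact_split dn) dvdn_mulr.
  rewrite natrM -scalerA; apply: (integralZ k); rewrite scalerAr.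
  by apply: integralM pint; apply: integralM.
- move=> v f f0; rewrite UE !(rmorphD, rmorphMz, rmorphM, rmorphXn) /= TE //.
  rewrite (pE _ f) => [|I]; last exact: meval_z.
  by rewrite /X !mevalXU !point_xy !map_mpolyX !mevalXU mulrzr.
Qed.

(** Subtracting a large multiple of [#|I| ^ 2] makes any function submodular,
    hence every integral point lies on a line that meets the submodular
    functions in an infinite ray. *)
Lemma submodular_sub_square (W : {set 'I_n} -> nat) (t : nat) :
    W set0 = 0%N -> (\sum_I W I <= t)%N ->
  submodular (fun I => (W I)%:Z - (t * #|I| ^ 2)%N%:Z).
Proof.
move=> W0 leS; split=> [|I J]; first by rewrite W0 cards0 muln0 subrr.
have Wt A B : A != B -> (W A + W B <= t)%N.
  move=> AB; apply: leq_trans leS; rewrite (bigD1 A) //= (bigD1 B) 1?eq_sym //=.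
  by rewrite addnA leq_addr.
have cI := cardsID J I; have cJ := cardsID I J; have cU := cardsUI I J.
rewrite [J :&: I]setIC in cJ.
have [/eqP sIJ|nIJ] := eqVneq (I :\: J) set0.
  by rewrite setD_eq0 in sIJ; rewrite (setUidPr sIJ) (setIidPl sIJ) addrC.
have [/eqP sJI|nJI] := eqVneq (J :\: I) set0.
  by rewrite setD_eq0 in sJI; rewrite (setUidPl sJI) (setIidPr sJI).
have a0 : (0 < #|I :\: J|)%N by rewrite card_gt0.
have b0 : (0 < #|J :\: I|)%N by rewrite card_gt0.
have nUI : I :|: J != I :&: J.
  apply: contra nIJ => /eqP e; rewrite setD_eq0.
  by apply: subset_trans (subsetUl I J) _; rewrite e subsetIr.
have tU := Wt _ _ nUI.
move: cU; rewrite -cI -cJ; move: #|_ :|: _| #|_ :&: _| a0 b0 => c k.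
move: #|_ :\: _| #|_ :\: _| => a b a0 b0 cE.
have {cE} -> : c = (k + a + b)%N by lia.
have le_t : (t <= t * (a * b))%N by rewrite leq_pmulr // muln_gt0 a0 b0.
have sq : (t * (k + a + b) ^ 2 + t * k ^ 2 =
    t * (k + a) ^ 2 + t * (k + b) ^ 2 + 2 * (t * (a * b)))%N by rewrite -!mulnn; lia.
lia.
Qed.

Lemma mpoly_submodular_eval0 T :
  (forall v f, submodular f -> T.@[specialization_point v f] = 0) -> T = 0.
Proof.
move=> T0; apply: mpoly_nat_eval0 => w.
pose W I := if insub I is Some J then w (enum_rank (inr J : var n)) else 0%N.
have W0 : W set0 = 0%N by rewrite /W insubF // eqxx.
(* The line through [w] in the direction of [I |-> - #|I| ^ 2]. *)
pose s (k : 'I_N) := if enum_val k is inr J then (#|val J| ^ 2)%N else 0%N.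
pose c k : {poly rat} := (w k)%:R%:P - (s k)%:R *: 'X.
have cE t k : (c k).[t] = (w k)%:R - (s k)%:R * t.
  by rewrite /c !hornerE.
have curve0 : restrict_to_curve c T = 0.
  apply: (@poly_nat_roots _ (\sum_I W I)) => t le_t; rewrite horner_curve.
  rewrite -[RHS](T0 (fun i => (w (xy_index i))%:R) _
                    (submodular_sub_square W0 le_t)).
  apply: meval_eq => k; rewrite cE /s /specialization_point /xy_index -[k]enum_valK.
  case: (enum_val k) => [i|J]; rewrite !enum_rankK; first by rewrite mul0r subr0.
  by rewrite /W valK rmorphB /= -!pmulrn mulrC -natrM.
have := horner_curve c T 0; rewrite curve0 horner0 => /esym E; rewrite -[RHS]E.
by apply: meval_eq => k; rewrite cE mulr0 subr0.
Qed.

Lemma interpolates_unique T T' :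
  interpolates_tutte T -> interpolates_tutte T' -> T = T'.
Proof.
move=> TI TI'; apply/eqP; rewrite -subr_eq0; apply/eqP.
apply: mpoly_submodular_eval0 => v f fS.
by rewrite mevalB -!meval_specialize TI // TI' // subrr.
Qed.

Lemma interpolates_exists : exists T,
  [/\ interpolates_tutte T, (msize T <= n.+1)%N & integral (n.-1`!%:R *: T)].
Proof.
have [U cU UE] := tutte_chain_poly n.
have [T [Tn Tint TE]] := chain_poly_mpoly cU; exists T; split=> // f fS.
apply/eqP; rewrite -subr_eq0; apply/eqP; apply: mpoly_nat_eval0 => v.
pose g := [ffun I => f I]; have fg : f =1 g by move=> I; rewrite ffunE.
rewrite mevalB meval_specialize (polymatroid_eq fg).
have gS := submodular_eq fg fS; rewrite UE // -TE ?gS.1 //.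
apply/eqP; rewrite subr_eq0; apply/eqP/meval_eq => k.
by rewrite /specialization_point; case: (enum_val k) => // J; rewrite fg.
Qed.
End Universal.

Lemma tutte_zero n :
  tutte (polymatroid (fun _ : {set 'I_n} => 0)) = ('X_0 + 'X_1 - 1) ^+ n.
Proof.
elim: n => [|n IH]; first exact: tutte_0.
rewrite tutte_recursion //= /jump !subrr addr0.
have e : slice (fun _ : {set 'I_n.+1} => 0) 0 =1 (fun _ => 0).
  by move=> I; rewrite /slice subr0 minxx.
by rewrite (polymatroid_eq e) IH exprS; ring.
Qed.

(** The zero function gives [(x + y - 1) ^ n], which has degree [n] already
    along the line [y = 1]. *)
Lemma msize_interpolates n (T : {mpoly rat[#|var n|]}) :
  interpolates_tutte T -> (n < msize T)%N.
Proof.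
move=> TI; pose c (k : 'I_#|var n|) : {poly rat} :=
  if enum_val k is inl i then (if i == 0 then 'X else 1) else 0.
have c2 k : (size (c k) <= 2)%N.
  rewrite /c; case: (enum_val k) => [i|J]; last by rewrite size_poly0.
  by case: (i == 0); rewrite ?size_polyX ?size_poly1.
apply: leq_trans (size_curve T c2).
suff -> : restrict_to_curve c T = 'X^n by rewrite size_polyXn.
apply/eqP; rewrite -subr_eq0; apply/eqP; apply: (@poly_nat_roots _ 0) => t _.
pose v (i : 'I_2) : rat := if i == 0 then t%:R else 1.
have := meval_specialize v (fun=> 0) T; rewrite TI // tutte_zero => TE.
rewrite hornerD hornerN hornerXn horner_curve.
rewrite [X in X - _](_ : _ = T.@[specialization_point v (fun=> 0)]).
  rewrite -TE !(rmorphXn, rmorphB, rmorphD, rmorph1) /= !map_mpolyX !mevalXU.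
  by rewrite /v /= addrK subrr.
apply: meval_eq => k; rewrite /c /specialization_point /v; case: (enum_val k) => [i|J].
  by case: (i == 0); rewrite ?hornerX ?hornerC.
by rewrite horner0.
Qed.

Theorem theorem6p1 (n : nat) (n_gt0 : (0 < n)%N) :
  (exists! T : {mpoly rat[#|var n|]}, interpolates_tutte T) /\
  (forall T : {mpoly rat[#|var n|]}, interpolates_tutte T ->
     msize T = n.+1 /\ n.-1`!%:R *: T \is a mpolyOver #|var n| Num.int).
Proof.
have [T [TI Tn Tint]] := interpolates_exists n; split.
  by exists T; split=> // T'; apply: interpolates_unique.
move=> T' TI'; rewrite (interpolates_unique TI' TI); split.
  by apply/eqP; rewrite eqn_leq Tn msize_interpolates.
exact: integral_mpolyOver.
Qed.
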